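(* Let $p$ be an odd prime, $m$ a positive integer, $q=p^m$, $u$ a positive integer and $v=\gcd(m,u)$. Let $\mathrm{Tr}$ denote the trace map from $\mathbb{F}_q$ to $\mathbb{F}_p$. Let \[ D_2=\{(x,y)\in\mathbb{F}_q^2\setminus\{(0,0)\} : \mathrm{Tr}(x^2+y^{p^u+1})=0\}, \] and $C_{D_2}=\{c(a,b)=(\mathrm{Tr}(ax+by))_{(x,y)\in D_2} : a,b\in\mathbb{F}_q\}$. If $\frac{m}{v}\equiv 0\pmod 4$, then $C_{D_2}$ is a $[p^{2m-1}+p^{m+v}-p^{m+v-1}-1,2m]$ three-weight linear code over $\mathbb{F}_p$ whose weight distribution is: weight $0$ with multiplicity $1$; weight $(p-1)p^{2m-2}$ with multiplicity $(p^{m-v}-1)(p^{m-v-1}+1)$; weight $(p-1)p^{2m-2}\left(1+\frac{p-1}{p^{m-v}}\right)$ with multiplicity $p^{2m}-p^{2m-2v}$; and weight $(p-1)p^{2m-2}\left(1+\frac{1}{p^{m-v-1}}\right)$ with multiplicity $(p^{m-v}-1)p^{m-v-1}(p-1)$.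
   Context: An $[n,k]$ linear code over $\mathbb{F}_p$ is a $k$-dimensional subspace of $\mathbb{F}_p^n$. The multiplicity of a weight $w$ is the number of codewords of Hamming weight $w$; a code is $t$-weight if exactly $t$ nonzero weights occur. *)

(* Defs.v *)
From HB Require Import structures.
From mathcomp Require Import all_boot all_order all_algebra.
Set Implicit Arguments. Unset Strict Implicit. Unset Printing Implicit Defensive.
Import Order.TTheory GRing.Theory Num.Theory.
Local Open Scope ring_scope.

(* F plays the role of F_q with q = p^m (hypothesis #|F| = p^m in the theorem). *)

(* Absolute trace F_q -> F_p : Tr(x) = sum_{i<m} x^(p^i)  (values lie in the prime subfield). *)
Definition Tr (F : finFieldType) (p m : nat) (x : F) : F :=
  \sum_(i < m) x ^+ (p ^ i).

Definition D2 (F : finFieldType) (p m u : nat) : {set F * F} :=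
  [set xy : F * F | (xy != (0, 0)) &&
                    (Tr p m (xy.1 ^+ 2 + xy.2 ^+ (p ^ u + 1)%N) == 0)].

(* codeword c(a,b), represented as a function on F*F indexed by D_2
   (coordinates outside D_2 are set to 0 and are not coordinates of the code) *)
Definition cw (F : finFieldType) (p m u : nat) (a b : F) : {ffun F * F -> F} :=
  [ffun xy => if xy \in D2 F p m u then Tr p m (a * xy.1 + b * xy.2) else 0].

Definition code (F : finFieldType) (p m u : nat) : {set {ffun F * F -> F}} :=
  [set cw p m u ab.1 ab.2 | ab in [set: F * F]].

Definition wt (F : finFieldType) (p m u : nat) (c : {ffun F * F -> F}) : nat :=
  #|[set xy in D2 F p m u | c xy != 0]|.

Definition mult (F : finFieldType) (p m u : nat) (w : nat) : nat :=
  #|[set c in code F p m u | wt p m u c == w]|.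

Definition num_nz_weights (F : finFieldType) (p m u : nat) : nat :=
  size (undup [seq wt p m u c | c <- enum (code F p m u :\ [ffun=> (0 : F)])]).

(* Main.v *)
(* The map Q(x, y) = Tr(x^2 + y^(p^u+1)) is a quadratic form over F_p on F x F whose polar form
   is B(z, w) = pairing (polar z) w.  The number of its zeros and all weights follow from one
   totally isotropic subspace W equal to its own B-orthogonal: on a coset z + W the form Q is
   affine, and it is constant only for z in W.  The weight of the functional pairing a depends
   only on whether a = polar w with Q w = 0, a = polar w with Q w <> 0, or a is not a value of
   polar (equivalently, the functional does not vanish on the radical of B).

   To find W, write s for the map x -> x^(p^u) and pick i^2 = -1, a * s(a) = i / 2 and
   c = - 1 / (2a).  Then s(c) = i a and s(a) = - i c, so for x = a y + c s(y) the element
   x^2 + y s(y) has the form g - s(g), which has trace 0.  Adding the solutions t of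
   s(t) = - i t to the first coordinate makes W maximal.  These roots exist in F because
   p^(4v) - 1 divides #|F| - 1, where v = gcd(m, u). *)
Require Import Defs.
From HB Require Import structures.
From mathcomp Require Import all_boot all_order all_algebra all_fingroup all_solvable all_field.
From mathcomp Require Import zify ring.
Import Order.TTheory GRing.Theory Num.Theory.
Local Open Scope ring_scope.
Set Implicit Arguments. Unset Strict Implicit. Unset Printing Implicit Defensive.

(** * Level sets of functions with values in the prime subfield *)

Section Equidistribution.
Variables (p : nat) (F : finFieldType).
Hypotheses (p_pr : prime p) (charFp : p \in [pchar F]).

Lemma ord_eq_dvdn_sub n (k l : 'I_n) : (k <= l)%N -> (n %| l - k)%N -> k = l.
Proof.
move=> kl dv; apply: val_inj; apply/eqP; rewrite eqn_leq kl -subn_eq0 /=.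
by move: dv; rewrite /dvdn modn_small // (leq_ltn_trans (leq_subr _ _)).
Qed.

(** The copy of F_p inside [F], as the fixed points of Frobenius. *)
Definition primeSub (c : F) := c ^+ p == c.

Lemma primeSub0 : primeSub 0.
Proof. by rewrite /primeSub expr0n gtn_eqF ?prime_gt0 ?eqxx. Qed.

Lemma primeSubD c d : primeSub c -> primeSub d -> primeSub (c + d).
Proof.
move=> /eqP Fc /eqP Fd; apply/eqP.
by rewrite -{2}Fc -{2}Fd exprDn_pchar // pnatE.
Qed.

Lemma primeSubN c : primeSub c -> primeSub (- c).
Proof.
move=> /eqP Fc; apply/eqP.
by rewrite exprNn_pchar ?Fc // pnatE.
Qed.

(** The map n -> f + n s is injective for n < p, with values among the at most p roots of X^p - X,
    so it is a bijection onto the prime subfield. *)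
Lemma card_shift_hits f s c : primeSub f -> primeSub s -> primeSub c -> s != 0 ->
  #|[set n : 'I_p | f + s *+ n == c]| = 1%N.
Proof.
move=> Ff Fs Fc s0.
pose g (n : 'I_p) := f + s *+ n.
have ginj : injective g.
  have aux (k l : 'I_p) : (k <= l)%N -> g k = g l -> k = l.
    move=> kl /addrI; rewrite -(subnKC kl) mulrnDr => /eqP.
    rewrite -[X in X == _]addr0 (inj_eq (addrI _)) eq_sym => skl.
    move: skl; rewrite -mulr_natr mulf_eq0 (negPf s0) /= -(dvdn_pcharf charFp).
    exact: ord_eq_dvdn_sub.
  by move=> k l; case/orP: (leq_total k l) => kl E; [|apply: esym]; exact: aux.
have FsP n : primeSub (s *+ n).
  elim: n => [|n IHn]; first by rewrite mulr0n primeSub0.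
  by rewrite mulrS primeSubD.
have subS : g @: setT \subset [set x | primeSub x].
  by apply/subsetP=> _ /imsetP[n _ ->]; rewrite inE primeSubD.
have leS : (#|[set x : F | primeSub x]| <= p)%N.
  have szP : size ('X^p - 'X : {poly F}) = p.+1.
    by rewrite size_polyDl ?size_polyXn // size_polyN size_polyX ltnS prime_gt1.
  rewrite cardE -ltnS -szP; apply: max_poly_roots; last exact: enum_uniq.
  - by rewrite -size_poly_eq0 szP.
  apply/allP=> x; rewrite mem_enum inE => /eqP Fx.
  by rewrite rootE !hornerE ?hornerXn Fx subrr.
have imE : g @: setT = [set x | primeSub x].
  by apply/eqP; rewrite eqEcard subS card_imset // cardsT card_ord.
have: c \in g @: setT by rewrite imE inE.
case/imsetP=> k _ ck; apply/eqP/cards1P; exists k; apply/setP=> n.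
by rewrite !inE ck -/(g n) (inj_eq ginj).
Qed.

(* For each n < p the map tau^n permutes Z, so p * #{f = c} counts the pairs
   (z, n) with f (tau^n z) = f z + n * s z = c; each z has exactly one such n. *)
Lemma card_level (T : finType) (Z : {set T}) (tau : T -> T) (f s : T -> F) c :
    injective tau -> (forall z, z \in Z -> tau z \in Z) ->
    (forall z, z \in Z -> f (tau z) = f z + s z) ->
    (forall z, z \in Z -> s (tau z) = s z) ->
    (forall z, z \in Z -> s z != 0) ->
    (forall z, primeSub (f z)) -> (forall z, primeSub (s z)) -> primeSub c ->
  (#|[set z in Z | f z == c]| * p = #|Z|)%N.
Proof.
move=> tau_inj tauZ fD sE s0 Ff Fs Fc.
have it_inj n : injective (iter n tau).
  by elim: n => //= n IHn x y /tau_inj/IHn.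
have itZ n z : z \in Z -> [/\ iter n tau z \in Z, f (iter n tau z) = f z + s z *+ n
    & s (iter n tau z) = s z].
  move=> zZ; elim: n => [|n [IZ If Is]] /=; first by rewrite mulr0n addr0.
  by split; rewrite ?tauZ ?fD ?sE // If Is mulrSr addrA.
have itE n : iter n tau @^-1: Z = Z.
  apply/esym/eqP; rewrite eqEcard card_preimset // leqnn andbT.
  by apply/subsetP=> z zZ; rewrite inE; case: (itZ n z zZ).
have cardn n : #|[set z in Z | f z == c]| = #|[set z in Z | f z + s z *+ n == c]|.
  rewrite -(card_preimset _ (it_inj n)); apply: eq_card => z; rewrite !inE.
  have := itE n => /setP/(_ z); rewrite inE => ->.
  by case: (boolP (z \in Z)) => //= zZ; case: (itZ n z zZ) => _ -> _.
have -> : (#|[set z in Z | f z == c]| * p =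
   \sum_(n < p) #|[set z in Z | (f z + s z *+ n == c)%R]|)%N.
  rewrite (eq_bigr (fun=> #|[set z in Z | f z == c]|)) => [|n _]; last by rewrite -cardn.
  by rewrite sum_nat_const card_ord mulnC.
under eq_bigr => n _ do rewrite -sum1dep_card big_mkcondr /=.
rewrite exchange_big /= -sum1_card; apply: eq_bigr => z zZ.
rewrite -big_mkcond /= sum1dep_card.
by rewrite card_shift_hits // s0.
Qed.

End Equidistribution.

(** * Double counting in finite sets *)

Section FiniteSums.
Lemma sum_if_const (T : finType) (X P : {set T}) (a b : nat) :
  (\sum_(x in X) (if x \in P then a else b) = #|X :&: P| * a + #|X :\: P| * b)%N.
Proof.
rewrite (bigID [in P]) /= -!sum_nat_const; congr (_ + _)%N.
  by apply: eq_big => [x|x /andP[_ ->//]]; rewrite inE.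
by apply: eq_big => [x|x /andP[_ /negPf->//]]; rewrite inE andbC.
Qed.

(** Both sides count the pairs of [w] in [W] and [z] with [P (z + w)], each translation being a
    bijection. *)
Lemma card_average (V : finZmodType) (W : {set V}) (P : pred V) :
  (#|W| * #|[set z | P z]| = \sum_z #|[set w in W | P (z + w)%R]|)%N.
Proof.
rewrite -sum_nat_const.
transitivity (\sum_(w in W) #|[set z | P (z + w)%R]|)%N.
  apply: eq_bigr => w _; rewrite -(card_preimset [set z | P z] (addIr w)).
  by apply: eq_card => z; rewrite !inE.
under eq_bigr => w _ do rewrite -sum1dep_card big_mkcond.
rewrite exchange_big /=; apply: eq_bigr => z _.
by rewrite -big_mkcondr sum1dep_card.
Qed.
End FiniteSums.

(** * Additive functionals and orthogonal complements *)

Section Forms.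
Variables (p : nat) (F : finFieldType) (V : finZmodType).
Hypotheses (p_pr : prime p) (charFp : p \in [pchar F]).

Lemma card_functional (W : {set V}) (f : V -> F) w0 c :
    {in W &, forall x y, x + y \in W} -> {morph f : x y / x + y} ->
    (forall x, primeSub p (f x)) -> w0 \in W -> f w0 != 0 -> primeSub p c ->
  (#|[set w in W | f w == c]| * p = #|W|)%N.
Proof.
move=> WD fD Ff w0W fw0 Fc.
apply: (card_level p_pr charFp (tau := fun z => z + w0) (s := fun=> f w0)) => //.
- exact: addIr.
- by move=> z zW; exact: WD.
Qed.

(** Double counting of the pairs with [b z w = 0]: a row [z] holds all of [W] or a fraction 1/p of
    it, a column [w] all of [V] or a fraction 1/p of it. *)
Lemma card_orthogonal (b : V -> V -> F) (W : {set V}) :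
    {in W &, forall x y, x + y \in W} ->
    (forall z, {morph b z : x y / x + y}) ->
    (forall w, {morph b^~ w : x y / x + y}) ->
    (forall x y, primeSub p (b x y)) ->
  (#|[set z | [forall w in W, b z w == 0%R]]| * #|W| =
   #|V| * #|[set w in W | [forall z, b z w == 0%R]]|)%N.
Proof.
move=> WD bDr bDl Fb.
set A := [set z | _]; set R := [set w in W | _].
have F0 : primeSub p (0 : F) by exact: primeSub0.
have rowE z : (#|[set w in W | b z w == 0%R]| * p = if z \in A then #|W| * p else #|W|)%N.
  rewrite inE; case: ifP => [/forall_inP bz0|/negbT/forall_inPn[w wW bzw]].
    by congr (_ * _)%N; apply: eq_card => w; rewrite inE andb_idr // => /bz0.
  by apply: card_functional bzw F0.
have colE w : w \in W ->
    (#|[set z | b z w == 0%R]| * p = if w \in R then #|V| * p else #|V|)%N.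
  move=> wW; rewrite inE wW /=; case: ifP => [/forallP bw0|/negbT/forallPn[z bzw]].
    congr (_ * _)%N; rewrite -cardsT; apply: eq_card => z; rewrite !inE; exact: bw0.
  rewrite -cardsT -(card_functional _ (bDl w) (Fb^~ w) (in_setT z) bzw F0); last first.
    by move=> *; rewrite inE.
  by congr (_ * _)%N; apply: eq_card => x; rewrite !inE.
have: (\sum_z #|[set w in W | b z w == 0%R]| * p =
      \sum_(w in W) #|[set z | b z w == 0%R]| * p)%N.
  rewrite -!big_distrl /=; congr (_ * _)%N.
  under eq_bigr => z _ do rewrite -sum1dep_card big_mkcondr /=.
  rewrite exchange_big /=; apply: eq_bigr => w _.
  by rewrite -big_mkcond sum1dep_card.
under eq_bigr do rewrite rowE; under [in RHS]eq_bigr => w wW do rewrite colE //.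
rewrite (eq_bigl [in setT]) => [|z]; last by rewrite inE.
rewrite !sum_if_const setTI (setIidPr _); last by apply/subsetP=> w; rewrite inE => /andP[].
have := cardsD W R; rewrite (setIidPr _); last by apply/subsetP=> w; rewrite inE => /andP[].
have := cardsD setT A; rewrite setTI cardsT => -> ->.
have : (#|A| <= #|V|)%N by rewrite -cardsT subset_leq_card.
have : (#|R| <= #|W|)%N by apply/subset_leq_card/subsetP=> w; rewrite inE => /andP[].
move: (prime_gt1 p_pr) #|A| #|R| #|V| #|W| => p1 a r n w rw an.
have [-> ->]: w = (r + (w - r))%N /\ n = (a + (n - a))%N by lia.
by move: (w - r)%N (n - a)%N => w' n'; rewrite !addKn; nia.
Qed.
End Forms.

(** * Integer identities for the class sizes and the weights *)

Section Arithmetic.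
Local Open Scope nat_scope.

(** Here and below [N] is the number of zeros of the form, [c] is p^(m - v - 1) and [s] is p^(2v),
    the size of the radical. The term [c * s] stands on the left to avoid truncated subtraction. *)
Lemma im_isotropic_arith p c s N i : 0 < p -> 0 < c -> 0 < s ->
  N + c * s = p * c ^ 2 * s + p * c * s ->
  (1 + i) * s = N -> i = (p * c - 1) * (c + 1).
Proof.
case: p c => [|q] // [|d] // _ _ s0 E E2; subst N.
apply/eqP; rewrite -(eqn_pmul2r s0); apply/eqP; nia.
Qed.

Lemma im_anisotropic_arith p c s N i : 0 < p -> 0 < c -> 0 < s ->
  N + c * s = p * c ^ 2 * s + p * c * s ->
  i * s = p ^ 2 * c ^ 2 * s - N -> i = (p * c - 1) * c * (p - 1).
Proof.
case: p c => [|q] // [|d] // _ _ s0 E Ei.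
apply/eqP; rewrite -(eqn_pmul2r s0); apply/eqP; rewrite Ei.
have -> : N = q.+1 * d.+1 ^ 2 * s + q * d.+1 * s by nia.
nia.
Qed.

Lemma weight_isotropic_arith p c s w : 1 < p -> 0 < c -> 0 < s ->
   w * (p * p) = p.-1 * (p ^ 2 * c ^ 2 * s) -> w = (p - 1) * c ^ 2 * s.
Proof.
case: p c => [|q] // [|d] // _ _ s0 E.
apply/eqP; rewrite -(@eqn_pmul2r (q.+1 * q.+1)) // E; apply/eqP. nia.
Qed.

Lemma weight_anisotropic_arith p c s N w : 1 < p -> 0 < c -> 0 < s ->
  N + c * s = p * c ^ 2 * s + p * c * s ->
  (N - w) * p ^ 2 = p ^ 2 * c ^ 2 * s -> w = (p - 1) * c * s * (c + 1).
Proof.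
case: p c => [|q] // [|d] // _ _ s0 E E2.
have : (N - w) = d.+1 ^ 2 * s.
  apply/eqP; rewrite -(@eqn_pmul2r (q.+1 ^ 2)) ?expn_gt0 // E2; apply/eqP. nia.
nia.
Qed.

Lemma weight_generic_arith p c s N : 0 < p -> 0 < c -> N + c * s = p * c ^ 2 * s + p * c * s ->
  p.-1 * N = (p - 1) * c * s * (p * c + p - 1).
Proof.
case: p c => [|q] // [|d] // _ _ E.
have -> : N = q.+1 * d.+1 ^ 2 * s + q * d.+1 * s by nia.
nia.
Qed.

(** Without the common factor [(p - 1) * c * s], the comparisons with the third weight become p c <
    p c + p - 1 < p (c + 1). *)
Lemma weights_distinct p c s : 1 < p -> 0 < c -> 0 < s ->
  [/\ 0 < (p - 1) * c ^ 2 * s, 0 < (p - 1) * c * s * (c + 1),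
      0 < (p - 1) * c * s * (p * c + p - 1)
    & [/\ (p - 1) * c ^ 2 * s != (p - 1) * c * s * (c + 1),
          (p - 1) * c ^ 2 * s * p != (p - 1) * c * s * (p * c + p - 1)
        & (p - 1) * c * s * (c + 1) * p != (p - 1) * c * s * (p * c + p - 1)]].
Proof.
move=> p1 c0 s0.
have k0 : 0 < (p - 1) * c * s by rewrite !muln_gt0 subn_gt0 p1 c0.
have -> : (p - 1) * c ^ 2 * s = (p - 1) * c * s * c by lia.
move: ((p - 1) * c * s) k0 => k k0.
rewrite -(mulnA k c) -(mulnA k (c + 1)) !eqn_pmul2l // !muln_gt0 k0.
split; try lia; split; apply/eqP; nia.
Qed.
End Arithmetic.

(** * Quadratic forms with a self-orthogonal isotropic subspace *)

Section QuadraticForm.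
Variables (p : nat) (F : finFieldType) (V : finZmodType).
Hypotheses (p_pr : prime p) (p_odd : odd p) (charFp : p \in [pchar F]).
(** Two bilinear forms are in play: the nondegenerate [b], which turns vectors into functionals, and
    the possibly degenerate polar form [b (phi x) y] of [Q]. *)
Variables (b : V -> V -> F) (Q : V -> F) (phi : V -> V) (W : {set V}).
Hypotheses (bC : forall x y, b x y = b y x) (bDr : forall z, {morph b z : x y / x + y}).
Hypotheses (Fb : forall x y, primeSub p (b x y)) (FQ : forall x, primeSub p (Q x)).
Hypothesis b_nondeg : forall x, (forall y, b x y = 0) -> x = 0.
Hypotheses (phiD : {morph phi : x y / x + y}).
Hypothesis QD : forall x y, Q (x + y) = Q x + Q y + b (phi x) y.
Hypothesis Q2 : forall x, b (phi x) x = Q x *+ 2.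
Hypotheses (WD : {in W &, forall x y, x + y \in W}) (QW : {in W, forall w, Q w = 0}).
Hypothesis W_max : forall z, {in W, forall w, b (phi z) w = 0} -> z \in W.

Notation B x y := (b (phi x) y).

Let bDl w : {morph b^~ w : x y / x + y}.
Proof. by move=> x y /=; rewrite !(bC _ w) bDr. Qed.

Let b0r x : b x 0 = 0.
Proof. by apply: (addrI (b x 0)); rewrite -bDr !addr0. Qed.

Let b0l x : b 0 x = 0. Proof. by rewrite bC b0r. Qed.

Let phi0 : phi 0 = 0.
Proof. by apply: (addrI (phi 0)); rewrite -phiD !addr0. Qed.

Let bMn x y n : b x (y *+ n) = b x y *+ n.
Proof. by elim: n => [|n IHn]; rewrite ?mulr0n ?b0r // !mulrS bDr IHn. Qed.

Let phiMn x n : phi (x *+ n) = phi x *+ n.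
Proof. by elim: n => [|n IHn]; rewrite ?mulr0n ?phi0 // !mulrS phiD IHn. Qed.

Let bMnl x y n : b (x *+ n) y = b x y *+ n.
Proof. by rewrite bC bMn bC. Qed.

Let BC x y : B x y = B y x.
Proof. by apply: (addrI (Q x + Q y)); rewrite -QD addrC QD [Q y + _]addrC. Qed.

Let BW : {in W &, forall x y, B x y = 0}.
Proof.
move=> x y xW yW; have := QD x y.
by rewrite !QW ?WD // !add0r => <-.
Qed.

Let two0 : 2%:R != 0 :> F.
Proof.
rewrite -(dvdn_pcharf charFp) gtnNdvd //.
by case: (p) p_odd (prime_gt1 p_pr) => [|[|[]]].
Qed.

Let F0 : primeSub p (0 : F) := primeSub0 F p_pr.
Let p_gt0 := prime_gt0 p_pr.

Lemma mem_orthogonal z : [forall w in W, B z w == 0] = (z \in W).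
Proof.
apply/forall_inP/idP => [z0|zW w wW]; last by rewrite BW.
by apply: W_max => w /z0/eqP.
Qed.

Let W0 : 0 \in W.
Proof. by apply: W_max => w _; rewrite phi0 b0l. Qed.

Lemma card_ker (x : V) : x != 0 -> (#|[set z | b x z == 0%R]| * p = #|V|)%N.
Proof.
move=> x0; have [z bxz]: exists z, b x z != 0.
  apply/existsP; apply: contra_neqT x0 => /existsPn bx0; apply: b_nondeg => y.
  by apply/eqP; rewrite -[_ == _]negbK.
have TD : {in [set: V] &, forall x y, x + y \in [set: V]} by move=> *; rewrite inE.
rewrite -cardsT -(card_functional p_pr charFp TD (bDr x) (Fb x) (in_setT z) bxz F0).
by congr (_ * _)%N; apply: eq_card => y; rewrite !inE.
Qed.

Let WMn w n : w \in W -> w *+ n \in W.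
Proof. by move=> wW; elim: n => [|n IHn]; rewrite ?mulr0n // mulrS WD. Qed.

Notation N := #|[set z | Q z == 0]|.

(** Average over the cosets of [W], where [Q (z + w) = Q z + B z w]. For [z] outside [W] the
    functional [B z] is nonzero on [W] by maximality, so [Q] vanishes on 1/p of the coset. *)
Lemma card_isotropic : (N * p + #|W| = #|W| * p + #|V|)%N.
Proof.
have W_gt0 : (0 < #|W|)%N by rewrite (cardD1 0) W0.
have avg := card_average W (fun z => Q z == 0).
have E z : (#|[set w in W | Q (z + w)%R == 0%R]| * p =
            if z \in W then #|W| * p else #|W|)%N.
  have -> : [set w in W | Q (z + w) == 0] = [set w in W | B z w == - Q z].
    apply/setP=> w; rewrite !inE; apply: andb_id2l => wW.
    by rewrite QD (QW wW) addr0 addrC addr_eq0.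
  rewrite -mem_orthogonal; case: ifPn => [z0|/forall_inPn[w wW Bzw]].
    congr (_ * _)%N; apply: eq_card => w; rewrite !inE andb_idr // => wW.
    by rewrite (eqP (forall_inP z0 w wW)) QW ?oppr0 // -mem_orthogonal.
  by rewrite (card_functional p_pr charFp _ _ _ wW Bzw) // primeSubN.
have: (#|W| * N * p = \sum_z (if z \in W then #|W| * p else #|W|))%N.
  by rewrite avg big_distrl; apply: eq_bigr => z _; exact: E.
rewrite (eq_bigl [in setT]) => [|z]; last by rewrite inE.
rewrite sum_if_const setTI -/N.
have := cardsD setT W; rewrite setTI cardsT => ->.
have : (#|W| <= #|V|)%N by rewrite -cardsT subset_leq_card.
move: #|W| #|V| N W_gt0 => w n N w0 wn.
move=> E1.
have : (w * (N * p) = w * (w * p + (n - w)))%N by rewrite mulnA E1; lia.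
by move/eqP; rewrite eqn_pmul2l // => /eqP; lia.
Qed.

(* Translation by r preserves Q and moves the functional. *)
Lemma card_isotropic_ker_rad a r : phi r = 0 -> b a r != 0 ->
  (#|[set z | (Q z == 0%R) && (b a z == 0%R)]| * p = N)%N.
Proof.
move=> r0 bar; have Qr : Q r = 0.
  have := Q2 r; rewrite r0 b0l => /esym/eqP.
  by rewrite -mulr_natr mulf_eq0 (negPf two0) orbF => /eqP.
have:= @card_level p F p_pr charFp V [set z | Q z == 0] (fun z => z + r) (b a)
  (fun=> b a r) 0 _ _ _ _ _ _ _ F0.
move <- => //; first last.
- by move=> z _; rewrite bDr.
- by move=> z; rewrite !inE QD Qr BC r0 b0l !addr0.
- exact: addIr.
by congr (_ * _)%N; apply: eq_card => z; rewrite !inE.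
Qed.

(* On each line of direction w the form Q is affine, with slope B w z. *)
Lemma card_isotropic_isotropic w : phi w != 0 -> Q w = 0 ->
  (#|[set z | (Q z == 0%R) && (B w z != 0%R)]| * p ^ 2 = p.-1 * #|V|)%N.
Proof.
move=> w0 Qw.
have Bww : B w w = 0 by rewrite Q2 Qw mul0rn.
have K := card_ker w0.
have := @card_level p F p_pr charFp V [set z | B w z != 0] (fun z => z + w) Q
  (fun z => B w z) 0 _ _ _ _ _ _ _ F0.
have -> : [set z in [set z | B w z != 0] | Q z == 0] = [set z | (Q z == 0) && (B w z != 0)].
  by apply/setP=> z; rewrite !inE andbC.
move=> L; rewrite -mulnn mulnA L //; first last.
- by move=> z; rewrite inE.
- by move=> z _; rewrite bDr Bww addr0.
- by move=> z _; rewrite QD Qw addr0 BC.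
- by move=> z; rewrite !inE bDr Bww addr0.
- exact: addIr.
(* This complement of a hyperplane holds (p - 1)/p of [V], and [Q] vanishes on 1/p of it. *)
have -> : [set z | B w z != 0] = ~: [set z | B w z == 0].
  by apply/setP=> z; rewrite !inE.
have := cardsC [set z | B w z == 0]; rewrite -K.
by move: #|[set z | B w z == 0]| #|_| p_gt0 => x y; nia.
Qed.

(* A coset z + W meets the counted set in |W| / p points if z is in W, in none if z - n w is
   in W for some 0 < n < p, and in |W| / p^2 otherwise, two independent affine conditions
   being imposed. *)
Lemma card_isotropic_anisotropic w : Q w != 0 ->
  (#|[set z | (Q z == 0%R) && (B w z == 0%R)]| * p ^ 2 = #|V|)%N.
Proof.
move=> Qw; set N0 := #|_|.
have Bww : B w w != 0 by rewrite Q2 -mulr_natr mulf_neq0.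
have nwW : w \notin W by apply: contraNN Qw => /QW->.
have W_gt0 : (0 < #|W|)%N by rewrite (cardD1 0) W0.
have [w1 w1W Bww1]: exists2 x, x \in W & B w x != 0.
  by apply/exists_inP; rewrite -negb_forall_in mem_orthogonal.
(* The points [x] of [W] at which [B w (z + x)] vanishes. *)
pose Y z := [set x in W | B w x == - B w z].
have cardY z : (#|Y z| * p = #|W|)%N.
  by apply: (card_functional p_pr charFp _ _ _ w1W Bww1) => //; rewrite primeSubN.
(* The union of the cosets n w + W for n < p, disjoint because pairing with [w1] kills [W] but gives
   a nonzero value at [w]. *)
pose U := [set w *+ (xy.1 : 'I_p) + xy.2 | xy in setX setT W].
have cardU : #|U| = (p * #|W|)%N.
  rewrite card_in_imset ?cardsX ?cardsT ?card_ord // => -[m x] [n y].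
  rewrite !inE /= => xW yW E.
  have aux (k l : 'I_p) x' y' : x' \in W -> y' \in W -> (k <= l)%N ->
      w *+ k + x' = w *+ l + y' -> k = l.
    move=> x'W y'W kl; rewrite -(subnKC kl) mulrnDr -addrA => /addrI E'.
    have := BW x'W w1W; rewrite E' phiD phiMn bDl bMnl (BW y'W w1W) addr0 => /eqP.
    rewrite -mulr_natr mulf_eq0 (negPf Bww1) /= -(dvdn_pcharf charFp).
    exact: ord_eq_dvdn_sub.
  have mn : m = n.
    case/orP: (leq_total m n) => mn; [|apply: esym].
      exact: (aux _ _ _ _ xW yW mn E).
    exact: (aux _ _ _ _ yW xW mn (esym E)).
  by move: E; rewrite mn => /addrI->.
have subWU : W \subset U.
  apply/subsetP=> x xW; apply/imsetP; exists (Ordinal p_gt0, x); rewrite ?inE //.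
  by rewrite mulr0n add0r.
have E z : (#|[set x in W | (Q (z + x)%R == 0%R) && (B w (z + x)%R == 0%R)]| * p ^ 2 =
   #|W| * (if z \in W then p else if z \in U then 0 else 1))%N.
  have -> : [set x in W | (Q (z + x) == 0) && (B w (z + x) == 0)] =
      [set x in Y z | B z x == - Q z].
    apply/setP=> x; rewrite !inE -andbA; apply: andb_id2l => xW.
    by rewrite QD (QW xW) addr0 bDr addrC addr_eq0 andbC addrC addr_eq0 [B w x == _]eq_sym
      -eqr_oppLR eq_sym.
  rewrite -mulnn mulnA; case: ifPn => [zW|nzW].
    rewrite -(cardY z) -!mulnA; congr (_ * _)%N; apply: eq_card => x.
    by rewrite !inE andb_idr // => /andP[xW _]; rewrite (BW zW xW) (QW zW) oppr0.
  case: ifPn => [/imsetP[[n x]]|nzU].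
    (* For z = n w + x and [y] in [Y z], expansion gives Q (z + y) = - n^2 Q w. This is nonzero,
       because n = 0 would put [z] in [W]. *)
    rewrite inE /= => /andP[_ xW] zE; rewrite muln0 (_ : [set _ in _ | _] = set0) ?cards0 //.
    apply/setP=> y; rewrite !inE -andbA; apply/and3P=> -[yW /eqP By /eqP].
    have Qz : Q z = Q w *+ n ^ 2 + B w x *+ n.
      have QM k : Q (w *+ k) = Q w *+ k ^ 2.
        elim: k => [|k IHk]; first by rewrite mulr0n QW.
        rewrite mulrS QD IHk bMn Q2 -{1}(mulr1n (Q w)) -mulrnA -!mulrnDr -!mulnn.
        by congr (_ *+ _); clear; lia.
      by rewrite zE QD QM (QW xW) addr0 phiMn bMnl.
    have Bz : B z y = B w y *+ n.
      by rewrite zE phiD phiMn bDl bMnl (BW xW yW) addr0.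
    rewrite Qz Bz By zE bDr bMn Q2 -mulrnA mulNrn mulrnDl -mulrnA opprD opprD.
    move/addIr/oppr_inj/eqP; rewrite -subr_eq0 -mulrnBr; last by rewrite -mulnn; clear; nia.
    rewrite (_ : 2 * n * n - n ^ 2 = n * n)%N; last by rewrite -mulnn; clear; lia.
    rewrite -mulr_natr mulf_eq0 (negPf Qw) /= natrM mulf_eq0 orbb.
    rewrite -(dvdn_pcharf charFp) => dv.
    have n0 : (n : nat) = 0%N.
      by case: (posnP n) => // n_gt0; move: (dvdn_leq n_gt0 dv); rewrite leqNgt ltn_ord.
    by case/negP: nzW; rewrite zE n0 mulr0n add0r.
  rewrite muln1.
  (* Otherwise [B z] vanishes on the kernel of [B w] in [W], hence equals n [B w] on [W] for some n.
     Then z - n w is in [W] by maximality, so [z] is in [U]. *)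
  have [x0 x0W /andP[Bwx0 Bzx0]]: exists2 x, x \in W & (B w x == 0) && (B z x != 0).
    apply/exists_inP; apply: contraNT nzU; rewrite negb_exists_in => /forall_inP H.
    have shift f c : primeSub p f -> primeSub p c -> exists n : 'I_p, f + B w w1 *+ n = c.
      move=> Ff Fc; have /eqP/cards1P[n] := card_shift_hits p_pr charFp Ff (Fb (phi w) w1) Fc Bww1.
      by move/setP/(_ n); rewrite !inE eqxx => /eqP; exists n.
    have [n Bn] := shift 0 (B z w1) F0 (Fb _ _); rewrite add0r in Bn.
    have zn : z - w *+ n \in W.
      (* Adding [k] times [w1] moves [x] into the kernel of [B w]. *)
      apply: W_max => x xW; have [k Bk] := shift (B w x) 0 (Fb _ _) F0.
      have x'W : x + w1 *+ k \in W by rewrite WD ?WMn.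
      have := H _ x'W; rewrite !bDr !bMn Bk eqxx /= negbK -Bn => /eqP Bzx.
      apply: (addIr (B w w1 *+ n *+ k)).
      rewrite phiD bDl (_ : phi (- _) = - phi (w *+ n)); last first.
        by apply: (addrI (phi (w *+ n))); rewrite -phiD !subrr phi0.
      have bNl y : b (- y) x = - b y x.
        by apply: (addrI (b y x)); rewrite -bDl !subrr b0l.
      rewrite phiMn bNl bMnl addrAC Bzx !add0r.
      by apply: (addrI (B w x *+ n)); rewrite subrr -mulrnA mulnC mulrnA -mulrnDl Bk mul0rn.
    apply/imsetP; exists (n, z - w *+ n); rewrite ?inE //=.
    by rewrite addrC subrK.
  (* Translation by [x0] preserves [Y z] and shifts [B z] by a nonzero constant, so 1/p of [Y z] is
     counted. *)
  rewrite -(cardY z); congr (_ * _)%N.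
  apply: (card_level p_pr charFp (tau := fun x => x + x0) (s := fun=> B z x0)) => //.
  - exact: addIr.
  - by move=> x; rewrite !inE => /andP[xW Bx]; rewrite WD // bDr (eqP Bwx0) addr0.
  - by move=> x _; rewrite bDr.
  - by rewrite primeSubN.
have avg := card_average W (fun z => (Q z == 0) && (B w z == 0)).
have: (#|W| * N0 * p ^ 2 = #|W| * \sum_z (if z \in W then p else if z \in U then 0 else 1))%N.
  by rewrite avg big_distrl big_distrr; apply: eq_bigr => z _; exact: E.
move/eqP; rewrite -mulnA eqn_pmul2l // => /eqP->.
(* The sum over [W] is p |W| = |U|, the rest of [U] adds nothing, and each element outside [U] adds
   1: in total |V|. *)
rewrite (bigID [in U]) /= -(cardC [in U]) cardU; congr (_ + _)%N.
  transitivity (\sum_(z in U) if z \in W then p else 0)%N.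
    by apply: eq_bigr => z zU; rewrite zU.
  by rewrite sum_if_const (setIidPr subWU) muln0 addn0 mulnC.
rewrite -sum1_card; apply: eq_big => // z nzU; rewrite (negPf nzU) ifF //.
by apply: contraNF nzU; exact: (subsetP subWU).
Qed.

(** * The radical, the image of [phi] and the weights of functionals *)

Definition rad := [set z | phi z == 0].
(** This will be the Hamming weight of a codeword: the origin is also a zero of [Q], but every
    functional vanishes there. *)
Definition weight a := #|[set z | (Q z == 0) && (b a z != 0)]|.

(** Orthogonality count for the polar form and [W]: the orthogonal of [W] is [W], and the vectors of
    [W] orthogonal to all of [V] form the radical. *)
Lemma card_rad : (#|rad| * #|V| = #|W| ^ 2)%N.
Proof.
have BDl w : {morph (fun x => B x w) : x y / x + y}.
  by move=> x y /=; rewrite phiD bDl.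
have := card_orthogonal (b := fun x y => B x y) p_pr charFp WD
  (fun z => bDr (phi z)) BDl (fun x y => Fb (phi x) y).
rewrite (_ : [set z | _] = W); last by apply/setP=> z; rewrite inE mem_orthogonal.
rewrite (_ : [set w in W | _] = rad) => [E|]; first by rewrite mulnC -E mulnn.
apply/setP=> z; rewrite !inE; apply/andP/eqP=> [[_ /forallP z0]|z0].
  by apply: b_nondeg => y; rewrite BC; apply/eqP.
split; first by apply: W_max => w _; rewrite z0 b0l.
by apply/forallP=> y; rewrite BC z0 b0l.
Qed.

(** The fibres of [phi] are cosets of [rad], and [X] is a union of such cosets. *)
Lemma card_phi (X : {set V}) :
    (forall x r, x \in X -> phi r = 0 -> x + r \in X) ->
  (#|phi @: X| * #|rad| = #|X|)%N.
Proof.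
move=> Xrad; rewrite -sum_nat_const -[RHS]sum1_card [RHS](partition_big_imset phi) /=.
apply: eq_bigr => _ /imsetP[x xX ->].
rewrite sum1dep_card -(card_preimset rad (addIr (- x))).
apply: eq_card => y; rewrite !inE phiD.
have -> : phi (- x) = - phi x by apply: (addrI (phi x)); rewrite -phiD !subrr phi0.
rewrite subr_eq0; apply/idP/andP=> [/eqP yx|[]//].
split; last exact/eqP.
rewrite -[y](subrK x) addrC Xrad //; apply: (addIr (phi x)).
by rewrite -phiD subrK yx add0r.
Qed.

(** The image lies in the orthogonal of [rad] by symmetry of the polar form; both have |V| / |rad|
    elements, since [b] is nondegenerate. *)
Lemma mem_im_phi a : (a \in phi @: setT) = [forall r in rad, b a r == 0].
Proof.
set A := [set a | [forall r in rad, b a r == 0]].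
have radD : {in rad &, forall x y, x + y \in rad}.
  by move=> x y; rewrite !inE phiD => /eqP-> /eqP->; rewrite addr0.
have := card_orthogonal p_pr charFp radD bDr bDl Fb.
rewrite -/A (_ : [set w in rad | _] = [set 0]); last first.
  apply/setP=> z; rewrite !inE; apply/andP/eqP=> [[_ /forallP z0]|->].
    by apply: b_nondeg => y; rewrite bC; apply/eqP.
  by rewrite phi0 eqxx; split=> //; apply/forallP=> y; rewrite b0r.
rewrite cards1 muln1 => E.
suff -> : phi @: setT = A by rewrite inE.
apply/eqP; rewrite eqEcard; apply/andP; split.
  apply/subsetP=> _ /imsetP[w _ ->]; rewrite inE; apply/forall_inP=> r.
  by rewrite inE BC => /eqP->; rewrite b0l.
have rad_gt0 : (0 < #|rad|)%N by rewrite (cardD1 0) inE phi0 eqxx.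
rewrite -(leq_pmul2r rad_gt0) E -cardsT.
by rewrite (@card_phi setT) // => x r _ _; rewrite inE.
Qed.

Lemma weight0 : weight 0 = 0%N.
Proof. by apply: eq_card0 => z; rewrite inE b0l eqxx andbF. Qed.

(** Such a functional is nonzero at some radical vector, so its kernel holds exactly 1/p of the
    zeros of [Q]. *)
Lemma weight_notin_im a : a \notin phi @: setT -> (weight a * p = p.-1 * N)%N.
Proof.
rewrite mem_im_phi => /forall_inPn[r]; rewrite inE => /eqP r0 bar.
have K := card_isotropic_ker_rad r0 bar.
have := cardsID [set z | b a z == 0] [set z | Q z == 0].
rewrite (_ : _ :&: _ = [set z | (Q z == 0) && (b a z == 0)]); last by apply/setP=> z; rewrite !inE.
rewrite (_ : _ :\: _ = [set z | (Q z == 0) && (b a z != 0)]); last first.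
  by apply/setP=> z; rewrite !inE andbC.
rewrite -/(weight a); move: K p_gt0; case: (p) => // n.
by move: (weight a) #|_| #|_| => x y z; clear; nia.
Qed.

Lemma weight_phi_anisotropic w : Q w != 0 -> ((N - weight (phi w)) * p ^ 2 = #|V|)%N.
Proof.
move/card_isotropic_anisotropic <-; congr (_ * _)%N.
have := cardsID [set z | B w z == 0] [set z | Q z == 0].
rewrite (_ : _ :&: _ = [set z | (Q z == 0) && (B w z == 0)]); last by apply/setP=> z; rewrite !inE.
rewrite (_ : _ :\: _ = [set z | (Q z == 0) && (B w z != 0)]); last first.
  by apply/setP=> z; rewrite !inE andbC.
by rewrite -/(weight _) => <-; rewrite addnK.
Qed.

(** * Class sizes and the weight distribution *)

Section Distribution.
(* For the trace form, a = p^v and c = p^(m - v - 1). *)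
Variables a c : nat.
Hypotheses (a_gt1 : (1 < a)%N) (c_gt0 : (0 < c)%N).
Hypotheses (cardV : #|V| = (p ^ 2 * c ^ 2 * a ^ 2)%N) (cardW : #|W| = (p * c * a ^ 2)%N).

Lemma card_isotropicE : (N + c * a ^ 2 = p * c ^ 2 * a ^ 2 + p * c * a ^ 2)%N.
Proof.
apply/eqP; rewrite -(eqn_pmul2r p_gt0); apply/eqP.
have := card_isotropic; rewrite cardV cardW !expnS !expn0.
by move: N (p) => n q; clear; nia.
Qed.

Let card_radE : #|rad| = (a ^ 2)%N.
Proof.
have := card_rad; rewrite cardV cardW => E.
have k_gt0 : (0 < p ^ 2 * c ^ 2 * a ^ 2)%N by rewrite !muln_gt0 ?expn_gt0 p_gt0 c_gt0 (ltnW a_gt1).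
apply/eqP; rewrite -(eqn_pmul2r k_gt0) E; apply/eqP.
by rewrite -!mulnn; move: (p) c a; clear; lia.
Qed.

(** [Q] is constant on the fibres of [phi], so this class and the next are disjoint. The zero
    functional is removed because its weight is 0. *)
Definition im_isotropic := phi @: [set z | Q z == 0] :\ 0.
Definition im_anisotropic := phi @: [set z | Q z != 0].

Let a2_gt0 : (0 < a ^ 2)%N. Proof. by rewrite expn_gt0 ltnW. Qed.

Let p_gt1 := prime_gt1 p_pr.

Let Q_rad x r : phi r = 0 -> Q (x + r) = Q x.
Proof.
move=> r0; have Qr : Q r = 0.
  have := Q2 r; rewrite r0 b0l => /esym/eqP.
  by rewrite -mulr_natr mulf_eq0 (negPf two0) orbF => /eqP.
by rewrite QD BC r0 b0l Qr !addr0.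
Qed.

Lemma card_im_isotropic : #|im_isotropic| = ((p * c - 1) * (c + 1))%N.
Proof.
have : (#|phi @: [set z | Q z == 0%R]| * #|rad| = N)%N.
  by apply: card_phi => x r; rewrite !inE => Qx /Q_rad->.
rewrite (cardsD1 0) -/im_isotropic.
have -> : 0 \in phi @: [set z | Q z == 0].
  by apply/imsetP; exists 0; rewrite ?phi0 // inE QW.
by rewrite card_radE; exact: im_isotropic_arith card_isotropicE.
Qed.

Lemma card_im_anisotropic : #|im_anisotropic| = ((p * c - 1) * c * (p - 1))%N.
Proof.
have : (#|im_anisotropic| * #|rad| = #|V| - N)%N.
  rewrite card_phi => [|x r]; last by rewrite !inE => Qx /Q_rad->.
  rewrite (_ : [set z | Q z != 0] = ~: [set z | Q z == 0]); last by apply/setP=> z; rewrite !inE.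
  by rewrite -(cardsC [set z | Q z == 0]) addKn.
by rewrite card_radE cardV; exact: im_anisotropic_arith card_isotropicE.
Qed.

Lemma card_notin_im : #|~: phi @: setT| = (p ^ 2 * c ^ 2 * a ^ 2 - p ^ 2 * c ^ 2)%N.
Proof.
have : (#|phi @: [set: V]| * #|rad| = #|V|)%N.
  by rewrite card_phi ?cardsT // => x r _ _; rewrite inE.
have := cardsC (phi @: [set: V]).
rewrite card_radE cardV => C /eqP; rewrite eqn_pmul2r // => /eqP imE.
by rewrite -C imE addKn.
Qed.

(** Since c^2 a^2 = p^(2m - 2), these are (p - 1) p^(2m - 2) times 1, 1 + 1/c and, after division by
    p, 1 + (p - 1)/(p c). *)
Definition wtIsotropic := ((p - 1) * c ^ 2 * a ^ 2)%N.
Definition wtAnisotropic := ((p - 1) * c * a ^ 2 * (c + 1))%N.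
(* Multiplied by p, to avoid a division. *)
Definition p_wtGeneric := ((p - 1) * c * a ^ 2 * (p * c + p - 1))%N.

Lemma weight_im_isotropic x : x \in im_isotropic -> weight x = wtIsotropic.
Proof.
rewrite !inE => /andP[x0 /imsetP[w]]; rewrite inE => /eqP Qw xE.
have := card_isotropic_isotropic _ Qw; rewrite -xE => /(_ x0).
rewrite -/(weight x) cardV -mulnn.
exact: weight_isotropic_arith.
Qed.

Lemma weight_im_anisotropic x : x \in im_anisotropic -> weight x = wtAnisotropic.
Proof.
case/imsetP=> w; rewrite inE => /weight_phi_anisotropic E ->.
move: E; rewrite cardV.
exact: weight_anisotropic_arith card_isotropicE.
Qed.

Lemma weight_notin_imE x : x \notin phi @: setT -> (weight x * p = p_wtGeneric)%N.
Proof.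
move/weight_notin_im->; exact: weight_generic_arith card_isotropicE.
Qed.

Lemma im_cases x : [\/ x = 0, x \in im_isotropic, x \in im_anisotropic | x \in ~: phi @: setT].
Proof.
rewrite in_setC; case: (boolP (x \in phi @: setT)) => [/imsetP[w _ ->]|]; last by constructor 4.
have [->|w0] := eqVneq (phi w) 0; first by constructor 1.
have [Qw|Qw] := eqVneq (Q w) 0; [constructor 2|constructor 3].
  by rewrite !inE w0 imset_f // inE Qw.
by rewrite imset_f // inE.
Qed.

Lemma weight_neq :
  [/\ (0 < wtIsotropic)%N, (0 < wtAnisotropic)%N, (0 < p_wtGeneric)%N
    & [/\ wtIsotropic != wtAnisotropic, (wtIsotropic * p != p_wtGeneric)%N
        & (wtAnisotropic * p != p_wtGeneric)%N]].
Proof.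
exact: weights_distinct.
Qed.

(** The four classes cover [V] and their weights differ, so the weight determines the class. *)
Lemma weight_distribution :
  [/\ forall x, (weight x == 0%N) = (x == 0),
      forall x, (weight x == wtIsotropic) = (x \in im_isotropic),
      forall x, (weight x == wtAnisotropic) = (x \in im_anisotropic)
    & forall x, (weight x * p == p_wtGeneric)%N = (x \in ~: phi @: setT)].
Proof.
have [B0 C0 A0 [neBC neBA neCA]] := weight_neq.
split=> x; apply/eqP/idP.
- case: (im_cases x) => [->|xI|xI|xI]; rewrite ?eqxx //.
  + by rewrite weight_im_isotropic // => E; rewrite E in B0.
  + by rewrite weight_im_anisotropic // => E; rewrite E in C0.
  + by rewrite in_setC in xI; move: A0; rewrite -(weight_notin_imE xI) => A0 E; rewrite E in A0.
- by move/eqP->; exact: weight0.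
- case: (im_cases x) => [->|//|xI|xI].
  + by rewrite weight0 => E; rewrite -E in B0.
  + by rewrite weight_im_anisotropic // => /esym/eqP; rewrite (negPf neBC).
  + by rewrite in_setC in xI; move: neBA; rewrite -(weight_notin_imE xI) => + E; rewrite E eqxx.
- exact: weight_im_isotropic.
- case: (im_cases x) => [->|xI|//|xI].
  + by rewrite weight0 => E; rewrite -E in C0.
  + by rewrite weight_im_isotropic // => /eqP; rewrite (negPf neBC).
  + by rewrite in_setC in xI; move: neCA; rewrite -(weight_notin_imE xI) => + E; rewrite E eqxx.
- exact: weight_im_anisotropic.
- case: (im_cases x) => [->|xI|xI|//].
  + by rewrite weight0 mul0n => E; rewrite -E in A0.
  + by rewrite weight_im_isotropic // => /eqP; rewrite (negPf neBA).
  + by rewrite weight_im_anisotropic // => /eqP; rewrite (negPf neCA).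
- by rewrite in_setC; exact: weight_notin_imE.
Qed.

Lemma weight_cases x :
  [\/ x = 0, weight x = wtIsotropic, weight x = wtAnisotropic
    | (weight x * p = p_wtGeneric)%N].
Proof.
have [_ B C A] := weight_distribution; case: (im_cases x) => [->|xI|xI|xI].
- by constructor 1.
- by constructor 2; apply/eqP; rewrite B.
- by constructor 3; apply/eqP; rewrite C.
- by constructor 4; apply/eqP; rewrite A.
Qed.

Lemma card_wtIsotropic : #|[set x | weight x == wtIsotropic]| = ((p * c - 1) * (c + 1))%N.
Proof.
have [_ B _ _] := weight_distribution.
by rewrite -card_im_isotropic; apply: eq_card => x; rewrite inE B.
Qed.

Lemma card_wtAnisotropic : #|[set x | weight x == wtAnisotropic]| = ((p * c - 1) * c * (p - 1))%N.
Proof.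
have [_ _ C _] := weight_distribution.
by rewrite -card_im_anisotropic; apply: eq_card => x; rewrite inE C.
Qed.

Lemma card_wtGeneric w : (w * p = p_wtGeneric)%N ->
  #|[set x | weight x == w]| = (p ^ 2 * c ^ 2 * a ^ 2 - p ^ 2 * c ^ 2)%N.
Proof.
move=> wE; have [_ _ _ A] := weight_distribution.
by rewrite -card_notin_im; apply: eq_card => x; rewrite inE -A -wE eqn_pmul2r.
Qed.

(** Since a > 1, the image of [phi] is not all of [V]. The vector found stands for the weight known
    only through its multiple [p_wtGeneric]. *)
Lemma exists_wtGeneric : exists x, (weight x * p = p_wtGeneric)%N.
Proof.
have [_ _ _ A] := weight_distribution.
have /card_gt0P[x xI] : (0 < #|~: phi @: setT|)%N.
  rewrite card_notin_im subn_gt0 -{1}[(_ * c ^ 2)%N]muln1 ltn_pmul2l.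
    by rewrite -{1}(exp1n 2) ltn_exp2r.
  by rewrite muln_gt0 !expn_gt0 p_gt0 c_gt0.
by exists x; apply/eqP; rewrite A.
Qed.

Lemma weight_eq0 x : (weight x == 0%N) = (x == 0).
Proof. by have [-> _ _ _] := weight_distribution. Qed.

Lemma weight_table :
  [/\ forall x, (weight x == 0%N) = (x == 0),
      forall x, [\/ x = 0, weight x = wtIsotropic, weight x = wtAnisotropic
                  | (weight x * p = p_wtGeneric)%N],
      exists x, (weight x * p = p_wtGeneric)%N
    & [/\ #|[set x | weight x == wtIsotropic]| = ((p * c - 1) * (c + 1))%N,
          #|[set x | weight x == wtAnisotropic]| = ((p * c - 1) * c * (p - 1))%N
        & forall w, (w * p = p_wtGeneric)%N ->
            #|[set x | weight x == w]| = (p ^ 2 * c ^ 2 * a ^ 2 - p ^ 2 * c ^ 2)%N]].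
Proof.
split; [exact: weight_eq0|exact: weight_cases|exact: exists_wtGeneric|].
by split; [exact: card_wtIsotropic|exact: card_wtAnisotropic|exact: card_wtGeneric].
Qed.

End Distribution.
End QuadraticForm.

(** * Divisibility among numbers p^a - 1 *)

Section ExponentArithmetic.
Local Open Scope nat_scope.

(** Modulo [d] both p^a and p^b are 1, and a Bezout relation s a = t b + gcd(a, b) transfers this to
    the gcd. *)
Lemma dvdn_pred_exp_gcd p a b d : 0 < a ->
  d %| (p ^ a).-1 -> d %| (p ^ b).-1 -> d %| (p ^ gcdn a b).-1.
Proof.
move=> a_gt0 da db.
have [->|p_gt0] := posnP p; first by rewrite exp0n ?gcdn_gt0 ?a_gt0 // dvdn0.
have dX x k : d %| (p ^ x).-1 -> d %| (p ^ (k * x)).-1.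
  by move=> dx; rewrite mulnC expnM (dvdn_trans dx) // dvdn_pred_predX.
case: (egcdnP b a_gt0) => s t E _.
have := dX _ s da; rewrite E expnD => D1; have := dX _ t db => D2.
have X_gt0 e : 0 < p ^ e by rewrite expn_gt0 p_gt0.
move: (X_gt0 (t * b)) (X_gt0 (gcdn a b)) D1 D2.
move: (p ^ (t * b)) (p ^ gcdn a b) => [|x] [|y] // _ _.
have -> : (x.+1 * y.+1).-1 = x * y.+1 + y by lia.
by move=> D1 D2; move: D1; rewrite dvdn_addr // dvdn_mulr.
Qed.

Lemma dvdn_pred_exp p a b : a %| b -> (p ^ a).-1 %| (p ^ b).-1.
Proof. by case/dvdnP=> k ->; rewrite mulnC expnM dvdn_pred_predX. Qed.
End ExponentArithmetic.

(** * Existence of k-th roots in a finite field *)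

Section FiniteFieldRoots.
Variable F : finFieldType.
Let n := #|F|.-1.

(** Write c = g^j for a generator g of the cyclic unit group of order [n], and d = gcd(k, n). The
    hypothesis gives d | j, and d = s k modulo [n], so g^(s j / d) is a root. *)
Lemma finField_kth_root (c : F) k : (0 < k)%N -> c != 0 ->
  c ^+ (n %/ gcdn k n) = 1 -> exists x, x ^+ k = c.
Proof.
move=> k_gt0 c0 c1.
have n_gt0 : (0 < n)%N by rewrite /n -subn1 subn_gt0 finNzRing_gt1.
have /cyclicP[g gE] := field_unit_group_cyclic [set: {unit F}]%G.
have og : #[g]%g = n by rewrite /order -gE card_finField_unit.
have c_unit : c \is a GRing.unit by rewrite unitfE.
have: FinRing.unit F c_unit \in <[g]>%g by rewrite -gE inE.
case/cycleP=> j cj.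
have cE : c = val g ^+ j by rewrite -FinRing.val_unitX -cj.
pose d := gcdn k n; have d_gt0 : (0 < d)%N by rewrite gcdn_gt0 k_gt0.
have dn : (n %/ d * d = n)%N by rewrite divnK // dvdn_gcdr.
have dj : (d %| j)%N.
  have : (n %| j * (n %/ d))%N.
    rewrite -og order_dvdn expgM og; apply/eqP/val_inj.
    by rewrite !FinRing.val_unitX -cE c1.
  rewrite -{1}dn mulnC dvdn_pmul2r // divn_gt0 // dvdn_leq // dvdn_gcdr //.
case: (egcdnP n k_gt0) => s t E _.
exists (val (g ^+ (s * (j %/ d)))%g).
rewrite cE -!FinRing.val_unitX -expgM.
have -> : (s * (j %/ d) * k = n * (t * (j %/ d)) + j)%N.
  by rewrite mulnAC E mulnDl [(gcdn _ _ * _)%N]mulnC divnK // mulnAC mulnC.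
by rewrite expgD expgM -og expg_order expg1n mul1g.
Qed.
End FiniteFieldRoots.

(** * Fixed fields of Frobenius powers and the trace *)

Section Frobenius.
Variables (p m : nat) (F : finFieldType).
Hypotheses (p_pr : prime p) (m_gt0 : (0 < m)%N) (cardF : #|F| = (p ^ m)%N).

Let charFp : p \in [pchar F] := card_finPcharP cardF p_pr.
Let pcharX k : [pchar F].-nat (p ^ k)%N.
Proof. by rewrite pnatX pnatE ?charFp. Qed.

Let expm (x : F) k : x ^+ (p ^ (k * m)) = x.
Proof.
elim: k => [|k IHk]; first by rewrite expn0 expr1.
by rewrite mulSn expnD exprM -cardF expf_card IHk.
Qed.

(** The power p^m fixes all of [F]; a Bezout relation s m = t k + gcd(m, k) does the rest. *)
Lemma frobenius_fixed_gcd k (x : F) :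
  (x ^+ (p ^ k) == x) = (x ^+ (p ^ gcdn m k) == x).
Proof.
have itX j e (y : F) : y ^+ (p ^ e) = y -> y ^+ (p ^ (j * e)) = y.
  move=> ye; elim: j => [|j IHj]; first by rewrite expn0 expr1.
  by rewrite mulSn expnD exprM ye IHj.
apply/eqP/eqP=> [xk|xg]; last first.
  by have /dvdnP[j {1}->] := dvdn_gcdr m k; exact: itX.
case: (egcdnP k m_gt0) => s t E _.
by rewrite -[RHS](expm x s) E expnD exprM itX.
Qed.

(** X^(p^k) - X divides X^(p^m) - X, which splits over [F] with simple roots, so all of its p^k
    roots are in [F]. *)
Lemma card_frobenius_fixed k : (k %| m)%N -> #|[set x : F | x ^+ (p ^ k) == x]| = (p ^ k)%N.
Proof.
case/dvdnP=> j mE.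
have k_gt0 : (0 < k)%N by move: m_gt0; rewrite mE muln_gt0 => /andP[].
pose P : {poly F} := 'X^(p ^ k) - 'X.
have pk_gt1 : (1 < p ^ k)%N by rewrite -(exp1n k) ltn_exp2r // prime_gt1.
have szP : size P = (p ^ k).+1.
  by rewrite size_polyDl ?size_polyXn // size_polyN size_polyX ltnS.
have rootP x : root P x = (x ^+ (p ^ k) == x).
  by rewrite rootE !hornerE ?hornerXn subr_eq0.
apply/eqP; rewrite eqn_leq; apply/andP; split.
  rewrite cardE -ltnS -szP; apply: max_poly_roots; last exact: enum_uniq.
  - by rewrite -size_poly_eq0 szP.
  by apply/allP=> x; rewrite mem_enum inE rootP.
have dvdP i : P %| 'X^(p ^ (i * k)) - 'X.
  elim: i => [|i IHi]; first by rewrite mul0n expn0 expr1 subrr dvdp0.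
  have -> : 'X^(p ^ (i.+1 * k)) - 'X = ('X^(p ^ (i * k)) - 'X) ^+ (p ^ k) + P.
    have charP : [pchar {poly F}].-nat (p ^ k)%N by rewrite pnatX pnatE // pchar_poly charFp.
    rewrite exprDn_pchar // exprNn_pchar //.
    by rewrite -exprM -expnD mulSn addnC /P addrA subrK.
  by rewrite dvdp_add // dvdp_exp // expn_gt0 prime_gt0.
have := dvdP j; rewrite -mE -cardF finField_genPoly => /dvdp_prod_XsubC[ms Pms].
have := eqp_size Pms; rewrite szP size_prod_XsubC => -[szE].
apply: (@leq_trans #|mask ms (index_enum F)|).
  by rewrite (card_uniqP (mask_uniq (index_enum_uniq F) ms)) -szE.
apply/subset_leq_card/subsetP=> x xms; rewrite inE -rootP (eqp_root Pms).
by rewrite root_prod_XsubC.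
Qed.

Local Notation tr := (Tr p m).

Lemma TrD : {morph (@Tr F p m) : x y / x + y}.
Proof.
by move=> x y; rewrite /Tr -big_split; apply: eq_bigr => i _; rewrite exprDn_pchar.
Qed.

(** A p-th power permutes the summands of the trace cyclically, as x^(p^m) = x. *)
Lemma Tr_frobenius k (x : F) : tr (x ^+ (p ^ k)) = tr x.
Proof.
elim: k => [|k IHk]; first by rewrite expn0 expr1.
rewrite expnSr exprM -[RHS]IHk; move: (x ^+ _) => y; rewrite /Tr.
under eq_bigr => i _ do rewrite -exprM -expnS.
have := expm y 1; rewrite mul1n; case: (m) m_gt0 => // m' _ ym.
by rewrite big_ord_recr big_ord_recl /= ym expn0 expr1 addrC.
Qed.

Lemma primeSub_Tr (x : F) : primeSub p (tr x).
Proof.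
apply/eqP; rewrite -[RHS](Tr_frobenius 1) -(pFrobenius_autE charFp) rmorph_sum.
by apply: eq_bigr => i _; rewrite /= pFrobenius_autE -!exprM mulnC expn1.
Qed.

(** For x != 0 the trace would vanish identically, although its polynomial has degree below |F| and
    coefficient 1 at X. *)
Lemma Tr_nondegenerate (x : F) : (forall y, tr (x * y) = 0) -> x = 0.
Proof.
move=> x_tr; apply/eqP; case: eqVneq => // x0.
have tr0 (y : F) : tr y = 0 by rewrite -(mulVKf x0 y) x_tr.
pose P : {poly F} := \sum_(i < m) 'X^(p ^ i).
have P0 : P = 0.
  apply: (@roots_geq_poly_eq0 _ P (enum F)).
  - by apply/allP=> y _; rewrite rootE horner_sum; apply/eqP; rewrite -[RHS](tr0 y);
      apply: eq_bigr => i _; rewrite hornerXn.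
  - exact: enum_uniq.
  rewrite -cardE cardF; apply: leq_trans (size_sum _ _ _) _.
  by apply/bigmax_leqP=> i _; rewrite size_polyXn ltn_exp2l // prime_gt1.
have: P`_1 = 1.
  rewrite /P; case: (m) m_gt0 => // m' _.
  rewrite big_ord_recl coefD coef_sum expn0 coefXn eqxx big1 ?addr0 // => i _.
  by rewrite coefXn eq_sym -(expn0 p) eqn_exp2l ?prime_gt1.
by rewrite P0 coef0 => /esym/eqP; rewrite oner_eq0.
Qed.
End Frobenius.

(** * The trace form and the roots needed for its isotropic subspace *)

HB.instance Definition _ (U V : finZmodType) := GRing.Zmodule.on (U * V)%type.

Section TraceForm.
Variables (p m u : nat) (F : finFieldType).
Hypotheses (p_pr : prime p) (p_odd : odd p) (m_gt0 : (0 < m)%N) (u_gt0 : (0 < u)%N).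
Hypothesis cardF : #|F| = (p ^ m)%N.
Let v := gcdn m u.
Hypothesis mv4 : ((m %/ v) %% 4 = 0)%N.

Let charFp : p \in [pchar F] := card_finPcharP cardF p_pr.
Let pcharX k : [pchar F].-nat (p ^ k)%N.
Proof. by rewrite pnatX pnatE ?charFp. Qed.

Let v_gt0 : (0 < v)%N. Proof. by rewrite gcdn_gt0 m_gt0. Qed.

Let dvdn_4v : (4 * v %| m)%N.
Proof.
have vm : (v %| m)%N by exact: dvdn_gcdl.
by rewrite -(divnK vm) dvdn_pmul2r // /dvdn mv4.
Qed.

(** If u / v were even, 2v would divide both m and u, hence v. This form shows that p^u is p^v
    modulo p^(2v) - 1. *)
Let u_odd_multiple : exists h, u = (v + h * (2 * v))%N.
Proof.
have /dvdnP[k uE] : (v %| u)%N by exact: dvdn_gcdr.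
have k_odd : odd k.
  apply/negPn/negP => k_even.
  have : (2 * v %| v)%N.
    rewrite {2}/v dvdn_gcd (dvdn_trans _ dvdn_4v) ?dvdn_pmul2r //=.
    by rewrite uE dvdn_pmul2r // dvdn2.
  by move/(dvdn_leq v_gt0); clear -v_gt0; lia.
exists k./2; rewrite uE -{1}(odd_double_half k) k_odd -mul2n; clear; lia.
Qed.

Let n := #|F|.-1.

Let two0 : 2%:R != 0 :> F.
Proof.
rewrite -(dvdn_pcharf charFp) gtnNdvd //.
by case: (p) p_odd (prime_gt1 p_pr) => [|[|[]]].
Qed.

(** [M] divides n / gcd(k, n), so c^M = 1 implies the criterion for k-th powers. *)
Let root_of_dvd (c : F) k D M : (0 < k)%N -> c != 0 -> n = (D * M)%N ->
  (gcdn k n %| D)%N -> c ^+ M = 1 -> exists x, x ^+ k = c.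
Proof.
move=> k_gt0 c0 nE /dvdnP[j DE] cM; apply: finField_kth_root => //.
have d_gt0 : (0 < gcdn k n)%N by rewrite gcdn_gt0 k_gt0.
rewrite -/n {1}nE DE mulnAC mulnK //.
by rewrite mulnC exprM cM expr1n.
Qed.

Let pred_cardE : exists L, n = ((p ^ v - 1) * (p ^ v + 1) * ((p ^ v) ^ 2 + 1) * L)%N.
Proof.
have /dvdnP[L nE] := dvdn_pred_exp p dvdn_4v.
exists L; rewrite /n cardF nE mulnC; congr (_ * _)%N.
rewrite [(4 * v)%N]mulnC expnM.
have : (0 < p ^ v)%N by rewrite expn_gt0 prime_gt0.
by case: (p ^ v)%N => // P _; clear; lia.
Qed.

Let half_pv : exists s, (p ^ v = 2 * s + 1)%N.
Proof.
exists (p ^ v)./2.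
by rewrite -{1}(odd_double_half (p ^ v)) oddX p_odd orbT -mul2n addnC.
Qed.

Lemma sqrt_minus_one : exists i : F, i ^+ 2 = -1.
Proof.
have [L nE] := pred_cardE; have [s sE] := half_pv.
(* With p^v = 2s + 1 the factor (p^v - 1)(p^v + 1) is 4 s (s + 1), so n / 2 is even. *)
apply: (root_of_dvd (D := 2) (M := 2 * s * (s + 1) * ((p ^ v) ^ 2 + 1) * L)) => //.
- by rewrite oppr_eq0 oner_eq0.
- by rewrite nE sE; clear; lia.
- exact: dvdn_gcdl.
- by rewrite -!mulnA exprM sqrrN expr1n expr1n.
Qed.

Section WithI.
Variable i : F.
Hypothesis ii : i ^+ 2 = -1.
Let i4 : i ^+ 4 = 1. Proof. by rewrite (exprM i 2 2) ii sqrrN expr1n. Qed.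

Let i0 : i != 0.
Proof. by have := expf_eq0 i 2; rewrite ii oppr_eq0 oner_eq0 => /esym/negbT. Qed.

(** A root of t^(p^u - 1) = - i is needed. The gcd of p^u - 1 and [n] divides p^v - 1, and the
    cofactor is a multiple of 4, the order of - i. *)
Lemma exists_twisted_root : exists2 t : F, t != 0 & t ^+ (p ^ u) = - i * t.
Proof.
have [L nE] := pred_cardE; have [s sE] := half_pv.
have pu_gt1 : (1 < p ^ u)%N by rewrite -(exp1n u) ltn_exp2r // prime_gt1.
have [|||||t tE] := @root_of_dvd (- i) (p ^ u - 1) (p ^ v - 1)
   ((p ^ v + 1) * ((p ^ v) ^ 2 + 1) * L).
- by rewrite subn_gt0.
- by rewrite oppr_eq0.
- by rewrite nE !mulnA.
- rewrite !subn1 /v gcdnC; apply: dvdn_pred_exp_gcd => //.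
    by rewrite -cardF dvdn_gcdl.
  by rewrite dvdn_gcdr.
- rewrite sE (_ : _ * L = 4 * ((s + 1) * (2 * s * s + 2 * s + 1) * L))%N; last by clear; lia.
  by rewrite exprM (exprM (- i) 2 2) sqrrN ii sqrrN !expr1n.
exists t; last by rewrite -tE -exprSr subn1 prednK // ltnW.
apply: contraNneq i0 => t0; move: tE; rewrite t0 expr0n.
by rewrite subn_eq0 leqNgt pu_gt1 -oppr_eq0 => <-.
Qed.

(** The equation is a^(p^u + 1) = i / 2. The gcd of p^u + 1 and [n] divides p^v + 1, and the
    cofactor is a multiple of 4 and of p - 1, so it kills both i and 2. *)
Lemma exists_norm_root : exists a : F, a * a ^+ (p ^ u) = i / 2%:R.
Proof.
have [L nE] := pred_cardE; have [s sE] := half_pv.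
have [|||||a aE] := @root_of_dvd (i / 2%:R) (p ^ u + 1) (p ^ v + 1)
   ((p ^ v - 1) * ((p ^ v) ^ 2 + 1) * L).
- by rewrite addn1.
- by rewrite mulf_neq0 ?invr_eq0.
- by rewrite nE; clear; lia.
- set d := gcdn _ _.
  have du : (d %| p ^ u + 1)%N by exact: dvdn_gcdl.
  have d2v : (d %| (p ^ (2 * v)).-1)%N.
    apply: (@dvdn_trans (p ^ gcdn m (2 * u)).-1).
      apply: dvdn_pred_exp_gcd => //; first by rewrite -cardF dvdn_gcdr.
      apply: dvdn_trans du _; rewrite mulnC expnM; case: (p ^ u)%N => // P.
      by rewrite (_ : (P.+1 ^ 2).-1 = P * (P.+1 + 1))%N ?dvdn_mull //; clear; lia.
    apply: dvdn_pred_exp; rewrite /v muln_gcdr dvdn_gcd dvdn_gcdr andbT.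
    exact: dvdn_trans (dvdn_gcdl _ _) (dvdn_mull _ _).
  (* As d divides p^(2v) - 1, it divides p^u + 1 only if it divides p^v + 1. *)
  have [h uE] := u_odd_multiple.
  have /dvdnP[y yE] : (d %| (p ^ (h * (2 * v))).-1)%N.
    exact: dvdn_trans d2v (dvdn_pred_exp _ (dvdn_mull _ _)).
  have pX : (p ^ (h * (2 * v)) = y * d + 1)%N.
    by rewrite -yE addn1 prednK // expn_gt0 prime_gt0.
  move: du; rewrite uE expnD pX.
  rewrite (_ : _ + 1 = p ^ v * y * d + (p ^ v + 1))%N; last by clear; lia.
  by rewrite dvdn_addr // dvdn_mull.
- have Mi : ((p ^ v - 1) * ((p ^ v) ^ 2 + 1) * L = 4 * (s * (2 * s * s + 2 * s + 1) * L))%N.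
    by rewrite sE; clear; lia.
  have two_p1 : (2%:R : F) ^+ (p - 1) = 1.
    apply: (mulfI two0); rewrite mulr1 -exprS subn1 prednK ?prime_gt0 //.
    by rewrite -(pFrobenius_autE charFp) pFrobenius_aut_nat.
  have /dvdnP[y yE] := dvdn_pred_predX p v.
  rewrite expr_div_n {1}Mi exprM i4 expr1n [(p ^ v - 1)%N]subn1 yE -!mulnA mulnCA exprM.
  by rewrite -subn1 two_p1 expr1n divr1.
by exists a; rewrite -exprS -addn1.
Qed.
End WithI.

Local Notation tr := (@Tr F p m).
Let V := (F * F)%type.
Let sigma (x : F) := x ^+ (p ^ u).
(** The inverse of [sigma], because u + u (m - 1) = u m; hence also its adjoint for the trace. *)
Let sigma' (x : F) := x ^+ (p ^ (u * m.-1)).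

Let sigmaD : {morph sigma : x y / x + y}.
Proof. by move=> x y; rewrite /sigma exprDn_pchar. Qed.

Let sigma'D : {morph sigma' : x y / x + y}.
Proof. by move=> x y; rewrite /sigma' exprDn_pchar. Qed.

Let sigmaN x : sigma (- x) = - sigma x.
Proof. by rewrite /sigma exprNn_pchar. Qed.

Let sigmaM x y : sigma (x * y) = sigma x * sigma y.
Proof. by rewrite /sigma exprMn. Qed.

Let sigmaK' x : sigma (sigma' x) = x.
Proof.
rewrite /sigma /sigma' -exprM -expnD -mulnSr prednK //.
elim: (u) => [|k IHk]; first by rewrite mul0n expr1.
by rewrite mulSn expnD exprM -cardF expf_card.
Qed.

Let tr_sigma x : tr (sigma x) = tr x := Tr_frobenius m_gt0 cardF u x.

Definition pairing (z w : F * F) : F := tr (z.1 * w.1 + z.2 * w.2).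
Definition quad (z : F * F) : F := tr (z.1 ^+ 2 + z.2 ^+ (p ^ u + 1)).
(** The polar form is Tr (2 x1 y1 + s(x2) y2 + x2 s(y2)); the adjoint [sigma'] turns its last term
    into a multiple of y2. *)
Definition polar (z : F * F) : F * F := (z.1 *+ 2, sigma z.2 + sigma' z.2).

Let trD := TrD p_pr cardF.

Let tr0 : tr (0 : F) = 0.
Proof. by apply: (addrI (tr 0)); rewrite -trD !addr0. Qed.

Let trN x : tr (- x) = - tr x.
Proof. by apply: (addrI (tr x)); rewrite -trD !subrr tr0. Qed.

Lemma pairingC z w : pairing z w = pairing w z.
Proof. by rewrite /pairing [z.1 * _]mulrC [z.2 * _]mulrC. Qed.

Lemma pairingDr z : {morph pairing z : x y / x + y}.
Proof. by move=> x y; rewrite /pairing -trD /=; congr tr; ring. Qed.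

Lemma pairing_nondegenerate z : (forall w, pairing z w = 0) -> z = 0.
Proof.
move=> z0; case: z z0 => x y z0; congr (_, _).
  apply: (Tr_nondegenerate p_pr m_gt0 cardF) => w.
  by have := z0 (w, 0); rewrite /pairing /= mulr0 addr0.
apply: (Tr_nondegenerate p_pr m_gt0 cardF) => w.
by have := z0 (0, w); rewrite /pairing /= mulr0 add0r.
Qed.

Lemma polarD : {morph polar : x y / x + y}.
Proof.
by move=> x y; congr (_, _) => /=; rewrite ?mulrnDl // sigmaD sigma'D addrACA.
Qed.

Let tr_sigma' x y : tr (sigma' x * y) = tr (x * sigma y).
Proof. by rewrite -tr_sigma sigmaM sigmaK'. Qed.

Let quadE z : quad z = tr (z.1 ^+ 2 + z.2 * sigma z.2).
Proof. by rewrite /quad addn1 [z.2 ^+ _]exprS. Qed.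

Lemma quadD x y : quad (x + y) = quad x + quad y + pairing (polar x) y.
Proof.
have -> : pairing (polar x) y = tr (x.1 *+ 2 * y.1 + sigma x.2 * y.2 + x.2 * sigma y.2).
  by rewrite [in RHS]trD -tr_sigma' -trD; congr tr; rewrite /=; ring.
by rewrite !quadE -!trD /= sigmaD; congr tr; ring.
Qed.

Lemma pairing_polar_diag x : pairing (polar x) x = quad x *+ 2.
Proof.
have -> : pairing (polar x) x = tr (x.1 *+ 2 * x.1 + sigma x.2 * x.2 + x.2 * sigma x.2).
  by rewrite [in RHS]trD -tr_sigma' -trD; congr tr; rewrite /=; ring.
by rewrite quadE [in RHS]mulr2n -trD; congr tr; ring.
Qed.

(** * The maximal isotropic subspace of the trace form *)

Section Isotropic.
Variables i a t0 : F.
Hypotheses (ii : i ^+ 2 = -1) (aE : a * sigma a = i / 2%:R).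
Hypotheses (t0_neq0 : t0 != 0) (t0E : sigma t0 = - i * t0).
Let c := - (2%:R * a)^-1.

Definition twisted := [set t | sigma t == - i * t].
(** The graph of y -> a y + c s(y), enlarged by [twisted] in the first coordinate. *)
Definition isoSpace := [set z : F * F | z.1 - (a * z.2 + c * sigma z.2) \in twisted].

Let i0 : i != 0.
Proof. by have := expf_eq0 i 2; rewrite ii oppr_eq0 oner_eq0 => /esym/negbT. Qed.

Let a0 : a != 0.
Proof.
apply: contraTneq isT => a0; move: aE; rewrite a0 mul0r => /esym/eqP.
by rewrite mulf_eq0 invr_eq0 (negPf i0) (negPf two0).
Qed.

Let acE : 2%:R * a * c = -1.
Proof. by rewrite /c mulrN divff // mulf_neq0. Qed.

Let sigma_a : sigma a = - i * c.
Proof. by apply: (mulfI a0); rewrite aE /c; field; rewrite two0 a0. Qed.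

Let sigma2 : sigma 2%:R = 2%:R.
Proof. by rewrite [2%:R]mulr2n sigmaD /sigma expr1n. Qed.

Let sigma_c : sigma c = i * a.
Proof.
have c0 : c != 0 by rewrite oppr_eq0 invr_eq0 mulf_neq0.
have k0 : 2%:R * (- i * c) != 0 by rewrite mulf_neq0 // mulf_neq0 // oppr_eq0.
have : sigma (2%:R * a * c) = -1 by rewrite acE sigmaN /sigma expr1n.
rewrite !sigmaM sigma2 sigma_a => E; apply: (mulfI k0); rewrite E.
rewrite (_ : _ * (i * a) = (- i ^+ 2) * (2%:R * a * c)); last by ring.
by rewrite ii acE opprK mul1r.
Qed.

(** A product t0 x is twisted exactly when [sigma] fixes x, that is, when x lies in the subfield of
    p^v elements. *)
Lemma card_twisted : #|twisted| = (p ^ v)%N.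
Proof.
rewrite -(card_frobenius_fixed p_pr m_gt0 cardF (dvdn_gcdl m u)) -/v.
have inj : injective (fun x => t0 * x) by exact: mulfI.
rewrite -(card_preimset _ inj); apply: eq_card => x; rewrite !inE -frobenius_fixed_gcd //.
have k0 : - i * t0 != 0 by rewrite mulf_neq0 ?oppr_eq0.
by rewrite sigmaM t0E mulrA (inj_eq (mulfI k0)).
Qed.

Lemma card_isoSpace : #|isoSpace| = (p ^ (m + v))%N.
Proof.
pose f (z : V) : V := (z.1 + (a * z.2 + c * sigma z.2), z.2).
have f_inj : injective f.
  by move=> [x y] [x' y'] [/= + yy]; rewrite yy => /addIr->.
rewrite -(card_preimset _ f_inj) expnD -cardF -card_twisted mulnC -[#|F|]cardsT -cardsX.
by apply: eq_card => -[x y]; rewrite !inE /= addrK andbT.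
Qed.

Lemma isoSpaceD : {in isoSpace &, forall x y, x + y \in isoSpace}.
Proof.
move=> [x y] [x' y']; rewrite !inE /= => /eqP xT /eqP yT.
have -> : x + x' - (a * (y + y') + c * sigma (y + y'))
    = (x - (a * y + c * sigma y)) + (x' - (a * y' + c * sigma y')) by rewrite sigmaD; ring.
by rewrite sigmaD xT yT -mulrDr.
Qed.

Lemma quad_isoSpace : {in isoSpace, forall z, quad z = 0}.
Proof.
move=> [x y]; rewrite inE /= inE; set t := x - _ => /eqP tE.
have xE : x = t + (a * y + c * sigma y) by rewrite subrK.
clearbody t.
(* [sigma] maps t^2 to (- i t)^2 = - t^2 and preserves the trace. *)
have trt : tr (t ^+ 2) = 0.
  have : tr (t ^+ 2) = - tr (t ^+ 2).
    rewrite -trN -{1}tr_sigma expr2 sigmaM tE; congr tr.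
    by rewrite -mulrACA mulrNN -expr2 ii mulN1r.
  move/eqP; rewrite -addr_eq0 -mulr2n -mulr_natr mulf_eq0 (negPf two0) orbF.
  by move/eqP.
(* In x^2 the cross term 2 a c y s(y) cancels y s(y); the terms with s(y) alone form - s(g), because
   s(a) = - i c and s(t) = - i t. *)
pose g := 2%:R * t * a * y + a ^+ 2 * y ^+ 2.
rewrite quadE /= (_ : _ + _ = t ^+ 2 + (g - sigma g)).
  by rewrite trD trt add0r trD trN tr_sigma subrr.
rewrite /g sigmaD !expr2 !sigmaM sigma2 sigma_a tE xE; move: (sigma y) => s.
transitivity (t * t + (2%:R * t * a * y + a * a * (y * y) - (2%:R * (- i * t) * (- i * c) * s
    + - i * c * (- i * c) * (s * s)))
  + ((2%:R * a * c + 1) * (y * s) + (1 + i ^+ 2) * (2%:R * t * c * s + c ^+ 2 * s ^+ 2))).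
  by ring.
by rewrite acE ii addNr subrr !mul0r !addr0.
Qed.

(** Testing on the graph vectors gives Tr (e y') = 0 for all y', so e = 0. Then - i a s(e) = s(t) +
    i t for t = x - (a y + c s(y)), so t is twisted. *)
Lemma isoSpace_max z : {in isoSpace, forall w, pairing (polar z) w = 0} -> z \in isoSpace.
Proof.
case: z => x y zW.
pose e := x *+ 2 * a + sigma' (x *+ 2 * c) + (sigma y + sigma' y).
have e0 : e = 0.
  apply: (Tr_nondegenerate p_pr m_gt0 cardF) => y'.
  have w_iso : (a * y' + c * sigma y', y') \in isoSpace.
    by rewrite !inE /= subrr mulr0 /sigma expr0n -leqn0 leqNgt expn_gt0 prime_gt0.
  have := zW _ w_iso; rewrite /pairing /polar /= => zw.
  rewrite -zw; transitivity (tr (x *+ 2 * a * y' + (sigma y + sigma' y) * y')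
      + tr (sigma' (x *+ 2 * c) * y')).
    by rewrite -trD; congr tr; rewrite /e; ring.
  by rewrite tr_sigma' -trD; congr tr; ring.
have : sigma e = 0 by rewrite e0 /sigma expr0n -leqn0 leqNgt expn_gt0 prime_gt0.
rewrite /e !sigmaD !sigmaK' sigmaM mulr2n sigmaD sigma_a => E.
rewrite !inE /= sigmaD sigmaN sigmaD !sigmaM sigma_a sigma_c -subr_eq0; apply/eqP.
move: (sigma x) (sigma y) (sigma (sigma y)) E => X s s2 E.
transitivity (- i * a * ((X + X) * (- i * c) + (x + x) * c + (s2 + y))
  + ((2%:R * a * c + 1) * (i * x + X) - (1 + i ^+ 2) * (2%:R * a * c * X))); first by ring.
by rewrite E acE ii addNr subrr !mul0r mulr0 subr0 addr0.
Qed.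
End Isotropic.

Lemma exists_isoSpace : exists W : {set F * F},
  [/\ {in W &, forall x y, x + y \in W}, {in W, forall z, quad z = 0},
      forall z, {in W, forall w, pairing (polar z) w = 0} -> z \in W
    & #|W| = (p ^ (m + v))%N].
Proof.
have [i ii] := sqrt_minus_one.
have [t0 t0_neq0 t0E] := exists_twisted_root ii; have [a aE] := exists_norm_root ii.
exists (isoSpace i a); split.
- exact: isoSpaceD.
- exact: quad_isoSpace.
- exact: isoSpace_max.
- exact: card_isoSpace t0_neq0 t0E.
Qed.
End TraceForm.

(** * From functionals to codewords *)

Section Codewords.
Variables (p m u : nat) (F : finFieldType).
Hypotheses (p_pr : prime p) (cardF : #|F| = (p ^ m)%N).
Let V := (F * F)%type.
Local Notation codeword ab := (cw p m u ab.1 ab.2).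
Local Notation wgt := (weight (@pairing p m F) (@quad p m u F)).
Hypothesis wgt_eq0 : forall ab : F * F, (wgt ab == 0%N) = (ab == 0).

Let tr0 : Tr p m (0 : F) = 0.
Proof. by apply: (addrI (Tr p m 0)); rewrite -(TrD p_pr cardF) !addr0. Qed.

Lemma wt_codeword (ab : F * F) : wt p m u (codeword ab) = wgt ab.
Proof.
apply: eq_card => xy; rewrite !inE ffunE inE /pairing /quad.
have [->|xy0] := eqVneq xy (0, 0); last by rewrite /=; case: (Tr p m (_ ^+ 2 + _) == 0).
by rewrite /= !mulr0 addr0 tr0 eqxx andbF.
Qed.

(** If two codewords agree, the difference of their parameters has weight 0 and is therefore 0. *)
Lemma codeword_inj : injective (fun ab : F * F => codeword ab).
Proof.
move=> x y xy; apply/eqP; rewrite -subr_eq0 -wgt_eq0; apply/eqP/eq_card0 => z.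
rewrite inE; apply/negP => /andP[Qz].
have [z0|z0] := eqVneq z (0, 0).
  by rewrite z0 /pairing /= !mulr0 addr0 tr0 eqxx.
have zD : z \in D2 F p m u by rewrite inE z0.
have := congr1 (fun c : {ffun V -> F} => c z) xy; rewrite /= !ffunE zD => E.
move/negP; apply; apply/eqP; apply: (addIr (Tr p m (y.1 * z.1 + y.2 * z.2))).
rewrite add0r -[RHS]E /pairing -(TrD p_pr cardF).
have [-> ->] : (x - y).1 = x.1 - y.1 /\ (x - y).2 = x.2 - y.2 by [].
by congr (Tr p m _); ring.
Qed.

Lemma card_codeE : #|code F p m u| = (#|F| * #|F|)%N.
Proof. by rewrite /code (card_imset _ codeword_inj) cardsT card_prod. Qed.

Lemma multE w : mult F p m u w = #|[set ab | wgt ab == w]|.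
Proof.
rewrite -(card_imset _ codeword_inj); apply: eq_card => c; rewrite inE.
apply/andP/imsetP=> [[/imsetP[ab _ ->]]|[ab]].
  by rewrite wt_codeword => wE; exists ab; rewrite ?inE.
by rewrite inE -wt_codeword => wE ->; split=> //; apply: imset_f.
Qed.

Lemma num_nz_weightsE (ws : seq nat) : uniq ws ->
    (forall w, w \in ws -> exists2 ab, ab != 0 & wgt ab = w) ->
    (forall ab, ab != 0 -> wgt ab \in ws) ->
  num_nz_weights F p m u = size ws.
Proof.
move=> ws_uniq ws_wgt wgt_ws.
have cw0 : codeword (0 : V) = [ffun=> 0].
  by apply/ffunP=> z; rewrite !ffunE /= !mul0r addr0 tr0 if_same.
apply/perm_size/uniq_perm; rewrite ?undup_uniq // => w; rewrite mem_undup.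
apply/mapP/idP=> [[c]|/ws_wgt[ab ab0 <-]].
  rewrite mem_enum !inE => /andP[c0 /imsetP[ab _ cE]] ->; rewrite cE wt_codeword wgt_ws //.
  by apply: contraNneq c0 => ab0; rewrite cE ab0 cw0.
exists (codeword ab); last by rewrite wt_codeword.
rewrite mem_enum !inE -cw0 (inj_eq codeword_inj) ab0 /=.
by apply/imsetP; exists ab.
Qed.

Lemma card_D2E : (#|D2 F p m u|.+1 = #|[set z : F * F | quad p m u z == 0%R]|)%N.
Proof.
have z0 : (0, 0) \in [set z : F * F | quad p m u z == 0].
  by rewrite inE /quad /= addn1 !expr0n addr0 tr0.
rewrite [RHS](cardsD1 (0, 0)) z0 add1n; congr _.+1.
by apply: eq_card => z; rewrite !inE.
Qed.
End Codewords.

(** * Parameters and weight distribution of the code *)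

Unset Implicit Arguments.

Theorem theorem6 (p m u : nat) (F : finFieldType) :
  prime p -> odd p -> (0 < m)%N -> (0 < u)%N ->
  #|F| = (p ^ m)%N ->
  let v := gcdn m u in
  ((m %/ v) %% 4 = 0)%N ->
  [/\ #|D2 F p m u| = (p ^ (2 * m - 1) + p ^ (m + v) - p ^ (m + v - 1) - 1)%N,
      #|code F p m u| = (p ^ (2 * m))%N,
      num_nz_weights F p m u = 3%N
    & [/\ mult F p m u 0 = 1%N,
      mult F p m u ((p - 1) * p ^ (2 * m - 2))
        = ((p ^ (m - v) - 1) * (p ^ (m - v - 1) + 1))%N,
      (forall w : nat,
         w%:R = ((p - 1) * p ^ (2 * m - 2))%:R
                * (1 + (p - 1)%:R / (p ^ (m - v))%:R) :> rat ->
         mult F p m u w = (p ^ (2 * m) - p ^ (2 * m - 2 * v))%N)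
    & (forall w : nat,
         w%:R = ((p - 1) * p ^ (2 * m - 2))%:R
                * (1 + 1 / (p ^ (m - v - 1))%:R) :> rat ->
         mult F p m u w = ((p ^ (m - v) - 1) * p ^ (m - v - 1) * (p - 1))%N)]].
Proof.
move=> p_pr p_odd m_gt0 u_gt0 cardF v mv4.
have v_gt0 : (0 < v)%N by rewrite gcdn_gt0 m_gt0.
have vm : (v %| m)%N by exact: dvdn_gcdl.
(* This bound makes the subtraction in m - v - 1 exact. *)
have mk : (4 * v <= m)%N.
  by rewrite dvdn_leq // -(divnK vm) dvdn_pmul2r // /dvdn mv4.
have p_gt0 := prime_gt0 p_pr; have p_gt1 := prime_gt1 p_pr.
pose a := (p ^ v)%N; pose c := (p ^ (m - v - 1))%N.
have a_gt1 : (1 < a)%N by rewrite -(exp1n v) ltn_exp2r.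
have c_gt0 : (0 < c)%N by rewrite expn_gt0 p_gt0.
have s_gt0 : (0 < a ^ 2)%N by rewrite expn_gt0 ltnW.
(* All powers of p become monomials in p, c and a, which turns the claims into polynomial
   identities. *)
have expE e x y z : e = (x + y * (m - v - 1) + z * v)%N -> (p ^ e = p ^ x * c ^ y * a ^ z)%N.
  by move->; rewrite !expnD ![(_ * (m - _ - _))%N]mulnC ![(_ * v)%N]mulnC !expnM.
have [E1 E2 E3] : [/\ p ^ (2 * m) = p ^ 2 * c ^ 2 * a ^ 2,
    p ^ (2 * m - 1) = p ^ 1 * c ^ 2 * a ^ 2 & p ^ (2 * m - 2) = p ^ 0 * c ^ 2 * a ^ 2]%N.
  by split; apply: expE; move: (v) mk v_gt0; clear; lia.
have [E4 E5] : (p ^ (m + v) = p ^ 1 * c ^ 1 * a ^ 2 /\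
    p ^ (m + v - 1) = p ^ 0 * c ^ 1 * a ^ 2)%N.
  by split; apply: expE; move: (v) mk v_gt0; clear; lia.
have [E6 E7] : (p ^ (m - v) = p ^ 1 * c ^ 1 * a ^ 0 /\
    p ^ (2 * m - 2 * v) = p ^ 2 * c ^ 2 * a ^ 0)%N.
  by split; apply: expE; move: (v) mk v_gt0; clear; lia.
rewrite E1 E2 E3 E4 E5 E6 E7 -/c !expn0 !expn1 !mul1n !muln1.
have charFp := card_finPcharP cardF p_pr.
have [W [WD QW Wmax cardW]] := exists_isoSpace p_pr p_odd m_gt0 u_gt0 cardF mv4.
rewrite -/v E4 !expn1 in cardW.
have cardV : #|[the finZmodType of (F * F)%type]| = (p ^ 2 * c ^ 2 * a ^ 2)%N.
  by rewrite -E1 card_prod cardF -expnD addnn mul2n.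
have bC := @pairingC p m F; have bDr := pairingDr p_pr cardF.
have Fb (z w : F * F) : primeSub p (pairing p m z w) by exact: (primeSub_Tr p_pr m_gt0 cardF).
have FQ (z : F * F) : primeSub p (quad p m u z) by exact: (primeSub_Tr p_pr m_gt0 cardF).
have bnd := @pairing_nondegenerate p m F p_pr m_gt0 cardF.
have phiD := polarD u p_pr cardF; have QD := quadD u p_pr m_gt0 cardF.
have Q2 := pairing_polar_diag u p_pr m_gt0 cardF.
have [eq0 cases [xA xAE] [cardB cardC cardA]] := weight_table p_pr p_odd charFp bC bDr Fb FQ
  bnd phiD QD Q2 WD QW Wmax a_gt1 c_gt0 cardV cardW.
have cardN := card_isotropicE p_pr p_odd charFp bC bDr Fb FQ phiD QD WD QW Wmax cardV cardW.
have [B0 C0 A0 [neBC neBA neCA]] := weights_distinct p_gt1 c_gt0 s_gt0.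
pose wgt := weight (@pairing p m F) (@quad p m u F).
rewrite -/wgt in eq0 cases xAE cardA cardB cardC.
split.
- move: cardN; rewrite -(card_D2E u p_pr cardF) -mulnn.
  move: (#|_|) c_gt0 s_gt0 p_gt0; clear; nia.
- by rewrite (card_codeE p_pr cardF eq0) cardF -expnD addnn -mul2n.
- have nz w k : (0 < k)%N -> #|[set ab | wgt ab == w]| = k ->
        exists ab, wgt ab = w.
    move=> k_gt0 wk.
    have /card_gt0P[ab] : (0 < #|[set ab | wgt ab == w]|)%N by rewrite wk.
    by rewrite inE => /eqP; exists ab.
  have wt0 : wgt 0 = 0%N by apply/eqP; rewrite eq0.
  have pc_gt1 : (1 < p * c)%N by rewrite (leq_trans p_gt1) // leq_pmulr.
  have [xB xBE] : exists ab, wgt ab = wtIsotropic p a c.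
    by apply: nz cardB; rewrite muln_gt0 subn_gt0 pc_gt1 addn1.
  have [xC xCE] : exists ab, wgt ab = wtAnisotropic p a c.
    by apply: nz cardC; rewrite !muln_gt0 !subn_gt0 pc_gt1 c_gt0 p_gt1.
  (* The third weight is given as the weight of [xA], to avoid a division by p. *)
  apply: (num_nz_weightsE p_pr cardF eq0
    (ws := [:: wtIsotropic p a c; wtAnisotropic p a c; wgt xA])).
  + rewrite /= !inE negb_or neBC /= andbT; apply/andP; split.
      by apply: contraNneq neBA; rewrite -/(wtIsotropic p a c) -/(p_wtGeneric p a c) -xAE => ->.
    by apply: contraNneq neCA; rewrite -/(wtAnisotropic p a c) -/(p_wtGeneric p a c) -xAE => ->.
  + have nz0 ab w : (0 < w)%N -> wgt ab = w -> ab != 0.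
      by move=> w_gt0 abw; rewrite -eq0 abw -lt0n.
    move=> w; rewrite !inE => /or3P[] /eqP->; [exists xB|exists xC|exists xA] => //.
    * exact: nz0 B0 xBE.
    * exact: nz0 C0 xCE.
    * apply: contraTneq A0 => xA0; rewrite -/(p_wtGeneric p a c) -xAE xA0 wt0 //.
  + move=> ab ab0; rewrite !inE -/(wgt ab).
    case: (cases ab) => [E|->|->|wA]; rewrite ?eqxx ?orbT //; first by rewrite E eqxx in ab0.
    have -> : wgt ab = wgt xA by apply/eqP; rewrite -(eqn_pmul2r p_gt0) wA -xAE.
    by rewrite eqxx !orbT.
rewrite !(multE p_pr cardF eq0); split.
- rewrite (eq_card (B := [set (0 : F * F)])) ?cards1 // => x; rewrite !inE; exact: eq0.
- by rewrite mulnA; exact: cardB.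
- move=> w wE; rewrite (multE p_pr cardF eq0) cardA //.
  have pc0 : (p * c)%:R != 0 :> rat by rewrite pnatr_eq0 -lt0n muln_gt0 p_gt0.
  (* Multiplication by p c = p^(m - v) clears the denominator of the rational hypothesis. *)
  have : (w * (p * c) = (p - 1) * (c ^ 2 * a ^ 2) * (p * c + (p - 1)))%N.
    apply/eqP; rewrite -(eqr_nat rat) natrM wE -mulrA mulrDl mul1r divfK //.
    by rewrite -natrD -natrM.
  rewrite /p_wtGeneric -addnBA // => wpc; apply/eqP; rewrite -(eqn_pmul2r c_gt0) -mulnA wpc -!mulnn.
  by apply/eqP; move: (p - 1)%N (p) (c) (a); clear; lia.
- move=> w wE; rewrite (multE p_pr cardF eq0) -cardC (_ : w = wtAnisotropic p a c) //.
  have c0 : c%:R != 0 :> rat by rewrite pnatr_eq0 -lt0n.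
  apply/eqP; rewrite -(eqn_pmul2r c_gt0); apply/eqP.
  transitivity ((p - 1) * (c ^ 2 * a ^ 2) * (c + 1))%N.
    apply/eqP; rewrite -(eqr_nat rat) natrM wE div1r -mulrA mulrDl mul1r mulVf //.
    by rewrite natr1 -natrM addn1.
  by rewrite /wtAnisotropic -!mulnn; move: (p - 1)%N (c) (a); clear; lia.
Qed.
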